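(* Let $k\ge2$ be an integer, $\varepsilon>0$, $\tau>0$, and let $(u_N^n)_{n\ge0}$ be real-valued functions in $Y_N$ satisfying the fully discrete Crank–Nicolson scheme $$\frac1\tau\bigl(u_N^{n+1}-u_N^n\bigr)+\varepsilon^2\partial_x^3u_N^{n+\frac12}+\frac1kP_N\partial_x\Bigl(\bigl(u_N^{n+\frac12}\bigr)^k\Bigr)=0,\qquad u_N^{n+\frac12}=\tfrac12\bigl(u_N^{n+1}+u_N^n\bigr),\quad n=0,1,\dots$$ Then the scheme preserves discrete mass and energy, i.e. $$M[u_N^n]=M[u_N^0],\qquad E[u_N^n]=E[u_N^0],\qquad n=0,1,\dots$$
   Context: $\mathbb T=(-\pi,\pi)$ with periodic boundary conditions; $N$ is an even positive integer; $Y_N=\operatorname{span}\{e^{\mathrm i\xi(x+\pi)}:\xi=-\frac N2,\dots,\frac N2\}$; $P_N:L^2(\mathbb T)\to Y_N$ is the $L^2$-orthogonal projection. The mass is $M[u]=\int_{\mathbb T}u(x)\,dx$ and the energy is $E[u]=\|u\|_{L^2(\mathbb T)}^2$. *)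

(* Defs.v *)
From mathcomp Require Export all_boot all_order all_algebra.
From mathcomp Require Export all_classical all_reals all_analysis.
From mathcomp Require Export complex.
Export Order.TTheory GRing.Theory Num.Theory.
Export numFieldNormedType.Exports.

Set Implicit Arguments.
Unset Strict Implicit.
Unset Printing Implicit Defensive.

Global Open Scope classical_set_scope.
Global Open Scope ring_scope.
Global Open Scope complex_scope.

(* MathComp-Analysis, with the complex numbers R[i] of real-closed.
   A function on the torus is represented by a function on the real line;
   integrals, norms and equations are taken on the fundamental domain
   ]-pi, pi[, and derivatives are those of functions on the line.  The elements
   of [trigpoly N] below are 2 pi-periodic by construction. *)
Definition torus (R : realType) : set R := `]- (pi : R), (pi : R)[%classic.
Arguments torus R : clear implicits.

(* exp (i t) *)
Definition cis (R : realType) (t : R) : R[i] := cos t +i* sin t.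

(* The space Y_N: the index j in {0, ..., N} stands for the frequency
   xi = j - N/2 in {-N/2, ..., N/2}, N being even. *)
Definition trigpoly (R : realType) (N : nat) : set (R -> R[i]) :=
  [set f | exists c : 'I_N.+1 -> R[i], forall x : R,
     f x = \sum_(j < N.+1) c j * cis ((j%:R - (N./2)%:R) * (x + pi))].

Definition real_trigpoly (R : realType) (N : nat) : set (R -> R) :=
  [set u | trigpoly N (fun x : R => (u x)%:C)].

Definition cintegral (R : realType) (f : R -> R[i]) : R[i] :=
  (\int[@lebesgue_measure R]_(x in torus R) complex.Re (f x)) +i*
  (\int[@lebesgue_measure R]_(x in torus R) complex.Im (f x)).

Definition L2dot (R : realType) (f g : R -> R[i]) : R[i] :=
  cintegral (fun x => f x * (g x)^*).

(* The L2-orthogonal projection P_N f, that is, the g in Y_N such that f - g is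
   orthogonal to Y_N.  For f in L2 there is exactly one such g (as a function on
   the line, since it is a trigonometric polynomial), so that the default value
   of xget is irrelevant. *)
Definition L2proj (R : realType) (N : nat) (f : R -> R[i]) : R -> R[i] :=
  xget (fun=> 0)
    [set g | trigpoly N g /\
       forall v, trigpoly N v -> L2dot (fun x => f x - g x) v = 0].

Definition mass (R : realType) (u : R -> R) : R :=
  \int[@lebesgue_measure R]_(x in torus R) u x.

(* u \_ torus is u on the torus and 0 elsewhere. *)
Definition L2norm (R : realType) (u : R -> R) : \bar R :=
  Lnorm (@lebesgue_measure R) 2%:E (EFin \o (u \_ (torus R))).

Definition energy (R : realType) (u : R -> R) : \bar R := (L2norm u ^+ 2)%E.

Definition half_step (R : realType) (u : nat -> R -> R) (n : nat) : R -> R :=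
  fun x => (u n.+1 x + u n x) / 2.

(* P_N acts on complex-valued functions, so the
   equation is one between complex numbers. *)
Definition crank_nicolson (R : realType) (N k : nat) (eps tau : R)
    (u : nat -> R -> R) : Prop :=
  forall (n : nat) (x : R), torus R x ->
    (tau^-1 * (u n.+1 x - u n x) + eps ^+ 2 * derive1n 3 (half_step u n) x)%:C
    + (k%:R^-1)%:C
      * L2proj N (fun y => (derive1 (fun z => half_step u n z ^+ k) y)%:C) x = 0.

(* Main.v *)
Require Import Defs.
From mathcomp Require Import ring.

(** Test the scheme against [v = 1] and against [v = h], the half step, both in
    [Y_N], so that [P_N] may be dropped.  The dispersive and nonlinear terms then
    become exact derivatives of periodic functions: [h'''] and [(h^k)'] for
    [v = 1], and
    [h''' h = (h'' h - h'^2 / 2)'], [(h^k)' h = (k / (k + 1) h^(k+1))'] for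
    [v = h].  What remains is the integral of [u_(n+1) - u_n], respectively of
    [(u_(n+1)^2 - u_n^2) / 2]. *)

Set Implicit Arguments.
Unset Strict Implicit.
Unset Printing Implicit Defensive.

Lemma continuous_mul (R : realType) (f g : R -> R) :
  continuous f -> continuous g -> continuous (fun x => f x * g x).
Proof. by move=> cf cg x; exact: (continuousM (cf x) (cg x)). Qed.

Lemma continuous_cstM (R : realType) (a : R) (f : R -> R) :
  continuous f -> continuous (fun x => a * f x).
Proof. by apply: continuous_mul => x; exact: cst_continuous. Qed.

Lemma continuous_sqr (R : realType) (f : R -> R) :
  continuous f -> continuous (fun x => f x ^+ 2).
Proof. by move=> cf; exact: continuous_mul. Qed.

Lemma is_derive_derive1 (R : realType) (F f : R -> R) :
  (forall x : R, is_derive x 1 F (f x)) -> derive1 F = f.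
Proof.
move=> dF; apply/funext => x.
by rewrite derive1E (@derive_val _ _ _ _ _ _ _ (dF x)).
Qed.

Lemma is_derive_continuous (R : realType) (F f : R -> R) :
  (forall x : R, is_derive x 1 F (f x)) -> continuous F.
Proof.
move=> dF x; apply/differentiable_continuous/derivable1_diffP.
exact: (@ex_derive _ _ _ _ _ _ _ (dF x)).
Qed.

Lemma integrable_torus (R : realType) (f : R -> R) :
  continuous f -> (@lebesgue_measure R).-integrable (torus R) (EFin \o f).
Proof.
move=> cf; have ic : (@lebesgue_measure R).-integrable `[- (pi : R), pi]%classic (EFin \o f).
  apply: continuous_compact_integrable; first exact: segment_compact.
  exact: continuous_subspaceT.
apply: integrableS ic; [exact: measurable_itv|exact: measurable_itv|].
exact: subset_itv_oo_cc.
Qed.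

(** Fundamental theorem of calculus with cancelling boundary values; this is what removes the
    dispersive and nonlinear terms. *)
Lemma Rintegral_torus_derive (R : realType) (F f : R -> R) :
  (forall x : R, is_derive x 1 F (f x)) -> continuous f -> F (- pi) = F pi ->
  \int[@lebesgue_measure R]_(x in torus R) f x = 0.
Proof.
move=> dF cf Fpi.
have cF := is_derive_continuous dF.
have npi : - pi < pi :> R by rewrite gtrN// pi_gt0.
(* The flags [true] and [false] select the closed interval, which differs from the torus by two null
   points. *)
rewrite /Rintegral /torus -(@integral_itv_bndoo _ _ _ _ true false); last first.
  by have /integrableP[] := integrable_torus cf.
rewrite (@continuous_FTC2 _ f F)//.
- by rewrite Fpi -EFinB subrr.
- exact: continuous_subspaceT.
- split; first by move=> x _; exact: (@ex_derive _ _ _ _ _ _ _ (dF x)).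
  + exact/cvg_at_right_filter/cF.
  + exact/cvg_at_left_filter/cF.
- by rewrite (is_derive_derive1 dF).
Qed.

Lemma energyE (R : realType) (u : R -> R) : continuous u ->
  energy u = (\int[@lebesgue_measure R]_(x in torus R) (u x ^+ 2))%:E.
Proof.
move=> cu; rewrite /energy /L2norm.
set I := \int[_]_(x in _) _.
have I0 : 0 <= I by apply: Rintegral_ge0 => x _; exact: sqr_ge0.
have c2 := continuous_sqr cu.
have IE : (\int[@lebesgue_measure R]_x
    (`|((EFin \o u \_ (torus R)) x)| `^ 2) = I%:E)%E.
  rewrite /I /Rintegral fineK; last first.
    by apply: integrable_fin_num; [exact: measurable_itv|exact: integrable_torus].
  rewrite [RHS]integral_mkcond; apply: eq_integral => x _.
  rewrite /patch /=; case: ifP => _.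
    by rewrite powR_mulrn// -normrX ger0_norm// sqr_ge0.
  (* Off the torus the restriction takes the default value [point], which is 0 in [R]. *)
  by rewrite [point](_ : _ = 0)// normr0 powR0.
rewrite unlock IE poweR_EFin -EFin_expe -powR_mulrn ?powR_ge0//.
by rewrite -powRrM mulVf// powRr1.
Qed.

(** Real form of [Y_N], in which calculus involves only real derivatives. Opposite frequencies both
    occur, so the coefficients are not unique. *)
Definition real_trig (R : realType) (N : nat) : set (R -> R) :=
  [set f | exists a b : 'I_N.+1 -> R, forall x : R,
     f x = \sum_(j < N.+1) (a j * cos ((j%:R - (N./2)%:R) * (x + pi))
                          + b j * sin ((j%:R - (N./2)%:R) * (x + pi)))].

(** Take real parts: [(p + i q) (cos t + i sin t)] has real part [p cos t - q sin t]. *)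
Lemma real_trigpoly_trig (R : realType) (N : nat) (u : R -> R) :
  real_trigpoly N u -> real_trig N u.
Proof.
case=> c uE; exists (fun j => complex.Re (c j)), (fun j => - complex.Im (c j)).
move=> x; have /(congr1 (@complex.Re R)) /= -> := uE x.
rewrite (big_morph (@complex.Re R) (id1 := 0) (op1 := +%R)) //; last by do 2 case=> ? ?.
by apply: eq_bigr => j _; case: (c j) => p q /=; rewrite mulNr.
Qed.

(** Differentiation keeps each frequency [w] and sends the coefficients [(a, b)] to [(w b, - w a)].
    Iterating it gives the derivatives of the half step. *)
Lemma real_trig_derive (R : realType) (N : nat) (f : R -> R) : real_trig N f ->
  exists2 f', real_trig N f' & forall x : R, is_derive x 1 f (f' x).
Proof.
case=> a [b fE]; pose w (j : 'I_N.+1) : R := j%:R - (N./2)%:R.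
exists (fun x => \sum_(j < N.+1) (w j * b j * cos (w j * (x + pi))
                          + - (w j * a j) * sin (w j * (x + pi)))).
  by exists (fun j => w j * b j), (fun j => - (w j * a j)).
move=> x.
have -> : f = \sum_(j < N.+1) (fun x => a j * cos (w j * (x + pi))
                          + b j * sin (w j * (x + pi))).
  by apply/funext => y; rewrite fct_sumE fE.
apply: is_derive_sum => j.
apply: is_derive_eq.
rewrite /GRing.scale/=; ring.
Qed.

Lemma real_trig_continuous (R : realType) (N : nat) (f : R -> R) :
  real_trig N f -> continuous f.
Proof. by case/real_trig_derive => f' _; exact: is_derive_continuous. Qed.

(** The frequency may be negative, so the difference is taken in [R] and split by the subtraction
    formulas into two natural multiples of [2 pi]. *)
Lemma cos_sin_full_turns (R : realType) (m n : nat) :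
  cos ((m%:R - n%:R) * (pi *+ 2)) = 1 :> R /\
  sin ((m%:R - n%:R) * (pi *+ 2)) = 0 :> R.
Proof.
have cosn k : cos (k%:R * (pi *+ 2)) = 1 :> R.
  by rewrite mulr_natl -[X in cos X]add0r (periodicn (@cosD2pi R)) cos0.
have sinn k : sin (k%:R * (pi *+ 2)) = 0 :> R.
  by rewrite mulr_natl -[X in sin X]add0r (periodicn (@sinD2pi R)) sin0.
by rewrite mulrBl cosB sinB !cosn !sinn !(mul0r, mulr0, mulr1) subrr addr0.
Qed.

Lemma real_trig_periodic (R : realType) (N : nat) (f : R -> R) :
  real_trig N f -> f (- pi) = f pi.
Proof.
case=> a [b fE]; rewrite !fE; apply: eq_bigr => j _.
have [c s] := cos_sin_full_turns R j N./2.
(* The phase is 0 at [- pi] and the frequency times [2 pi] at [pi]. *)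
by rewrite addNr mulr0 -mulr2n c s cos0 sin0.
Qed.

(** The constant 1 is the mode of frequency 0, whose index is [N./2]. *)
Lemma real_trigpoly1 (R : realType) (N : nat) : real_trigpoly N (fun=> 1 : R).
Proof.
have Hj : (N./2 < N.+1)%N by rewrite ltnS -divn2 leq_div.
exists (fun j => (j == Ordinal Hj)%:R) => x.
rewrite (bigD1 (Ordinal Hj))//= eqxx big1 ?addr0.
  by rewrite subrr mul0r mul1r /cis cos0 sin0.
by move=> j /negPf ->; rewrite mul0r.
Qed.

Lemma real_trigpolyD (R : realType) (N : nat) (u v : R -> R) :
  real_trigpoly N u -> real_trigpoly N v -> real_trigpoly N (fun x => u x + v x).
Proof.
case=> c uE [d vE]; exists (fun j => c j + d j) => x.
rewrite rmorphD /= uE vE -big_split /=.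
by apply: eq_bigr => j _; rewrite [RHS]mulrDl.
Qed.

Lemma real_trigpolyZ (R : realType) (N : nat) (a : R) (u : R -> R) :
  real_trigpoly N u -> real_trigpoly N (fun x => a * u x).
Proof.
case=> c uE; exists (fun j => a%:C * c j) => x.
by rewrite rmorphM /= uE mulr_sumr; apply: eq_bigr => j _; rewrite mulrA.
Qed.

Lemma real_trigpoly_half_step (R : realType) (N : nat) (u : nat -> R -> R) n :
  (forall n, real_trigpoly N (u n)) -> real_trigpoly N (half_step u n).
Proof.
move=> uY.
have -> : half_step u n = (fun x => 2^-1 * (u n.+1 x + u n x)).
  by apply/funext => x; rewrite /half_step mulrC.
exact/real_trigpolyZ/real_trigpolyD.
Qed.

Lemma L2dot_real (R : realType) (f v : R -> R) (g : R -> R[i]) :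
  L2dot (fun x => (f x)%:C - g x) (fun x => (v x)%:C) = 0 ->
  \int[@lebesgue_measure R]_(x in torus R) ((f x - complex.Re (g x)) * v x) = 0.
Proof.
move/(congr1 (@complex.Re R)) => /= <-; apply: eq_Rintegral => x _.
by case: (g x) => p q /=; rewrite oppr0 mulr0 subr0.
Qed.

(* [c = k^-1] when the projection exists; otherwise [L2proj] is its default value
   0 and [c = 0] does.  Conservation holds for every [c], so that the existence
   of the projection need not be established. *)
Lemma crank_nicolson_weak (R : realType) (N k : nat) (eps tau : R)
    (u : nat -> R -> R) (n : nat) :
  crank_nicolson N k eps tau u ->
  exists c : R, forall v : R -> R, real_trigpoly N v ->
    \int[@lebesgue_measure R]_(x in torus R)
      ((tau^-1 * (u n.+1 x - u n x) + eps ^+ 2 * derive1n 3 (half_step u n) x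
        + c * derive1 (fun z => half_step u n z ^+ k) x) * v x) = 0.
Proof.
move=> /(_ n); rewrite /L2proj.
set f := (fun z => _ ^+ k).
case: xgetP => [g _ [_ gP]|_] scheme; last first.
  exists 0 => v _; transitivity (\int[@lebesgue_measure R]_(x in torus R) (0 : R)); last first.
    by rewrite /Rintegral integral0.
  apply: eq_Rintegral.
  move=> x /set_mem /scheme /(congr1 (@complex.Re R)) /= /eqP.
  by rewrite !mulr0 subr0 addr0 mul0r addr0 => /eqP ->; rewrite mul0r.
exists k%:R^-1 => v vY.
(* Orthogonality is tested against [k^-1 v]: the scheme equates the linear part with [- k^-1 Re g],
   so both integrands become [k^-1 (f' - Re g) v]. *)
rewrite -(L2dot_real (gP _ (real_trigpolyZ k%:R^-1 vY))).
apply: eq_Rintegral => x /set_mem /scheme /(congr1 (@complex.Re R)) /=.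
case: (g x) => p q /=; rewrite mul0r subr0 => /eqP.
rewrite addr_eq0 => /eqP ->; ring.
Qed.

(** Common end of both conservation laws: [p] and [q] are the densities at consecutive times, and
    [r] collects the spatial terms. *)
Lemma Rintegral_torus_eq (R : realType) (a : R) (p q r : R -> R) :
  a != 0 -> continuous p -> continuous q -> continuous r ->
  \int[@lebesgue_measure R]_(x in torus R) r x = 0 ->
  \int[@lebesgue_measure R]_(x in torus R) (a * (p x - q x) + r x) = 0 ->
  \int[@lebesgue_measure R]_(x in torus R) p x =
  \int[@lebesgue_measure R]_(x in torus R) q x.
Proof.
move=> a0 cp cq cr r0.
have cpq : continuous (fun x => p x - q x).
  by move=> x; exact: (continuousB (cp x) (cq x)).
have capq := @continuous_cstM _ a _ cpq.
rewrite RintegralD; [|exact: measurable_itv|exact: integrable_torus..].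
rewrite r0 addr0 RintegralZl; [|exact: measurable_itv|exact: integrable_torus].
rewrite RintegralB; [|exact: measurable_itv|exact: integrable_torus..].
by move/eqP; rewrite mulf_eq0 (negPf a0) subr_eq0 => /eqP.
Qed.

Theorem lemma3p5 (R : realType) (N k : nat) (eps tau : R) (u : nat -> R -> R)
    (N_gt0 : (0 < N)%N) (N_even : ~~ odd N) (k_ge2 : (2 <= k)%N)
    (eps_gt0 : 0 < eps) (tau_gt0 : 0 < tau)
    (uY : forall n : nat, real_trigpoly N (u n))
    (u_scheme : crank_nicolson N k eps tau u) :
  forall n : nat, mass (u n) = mass (u 0%N) /\ energy (u n) = energy (u 0%N).
Proof.
have cu n : continuous (u n).
  exact/real_trig_continuous/real_trigpoly_trig.
have csq n := continuous_sqr (cu n).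
suff step n : mass (u n.+1) = mass (u n) /\ energy (u n.+1) = energy (u n).
  by elim=> // n [<- <-]; exact: step.
have hY := real_trigpoly_half_step n uY.
have [c weak] := crank_nicolson_weak n u_scheme.
have hT := real_trigpoly_trig hY.
set h := half_step u n in hY hT weak.
have [h1 h1T dh] := real_trig_derive hT.
have [h2 h2T dh1] := real_trig_derive h1T.
have [h3 h3T dh2] := real_trig_derive h2T.
have hD3 : derive1n 3 h = h3.
  by rewrite /= (is_derive_derive1 dh) (is_derive_derive1 dh1) (is_derive_derive1 dh2).
have dhX m x : is_derive (x : R) 1 (fun z => h z ^+ m) (m%:R * h x ^+ m.-1 * h1 x).
  have -> : (fun z => h z ^+ m) = h ^+ m by apply/funext => z; rewrite exprfctE.
  exact: is_deriveX.
rewrite {}hD3 (is_derive_derive1 (dhX k)) in weak.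
have ch := real_trig_continuous hT.
have ch1 := real_trig_continuous h1T.
have ch3 := real_trig_continuous h3T.
have chX m : continuous (fun z => h z ^+ m).
  by move=> x; exact: (continuous_comp (ch x) (@exprn_continuous _ m (h x))).
pose r x := eps ^+ 2 * h3 x + c * (k%:R * h x ^+ k.-1 * h1 x).
have cr : continuous r.
  have c1 := @continuous_cstM _ (eps ^+ 2) _ ch3.
  have c2 := continuous_mul (@continuous_cstM _ k%:R _ (chX k.-1)) ch1.
  by move=> x; exact: (continuousD (c1 x) (@continuous_cstM _ c _ c2 x)).
have tau0 : tau^-1 != 0 by rewrite invr_eq0 gt_eqF.
split.
  apply: (Rintegral_torus_eq tau0 (cu n.+1) (cu n) cr).
    pose F x := eps ^+ 2 * h2 x + c * h x ^+ k.
    have dF (x : R) : is_derive x 1 F (r x).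
      have := dhX k x; have := dh2 x => ? ?.
      apply: is_derive_eq; rewrite /r /GRing.scale/=; ring.
    apply: (Rintegral_torus_derive dF cr).
    by rewrite /F (real_trig_periodic hT) (real_trig_periodic h2T).
  rewrite -(weak _ (@real_trigpoly1 _ _)); apply: eq_Rintegral => x _.
  by rewrite mulr1 /r addrA.
rewrite !energyE//; congr EFin.
(* The factor 1/2 comes from [(u_(n+1) - u_n) h = (u_(n+1)^2 - u_n^2) / 2]. *)
have tau20 : tau^-1 / 2 != 0 by rewrite mulf_neq0// invr_eq0 pnatr_eq0.
have crh := continuous_mul cr ch.
apply: (Rintegral_torus_eq tau20 (csq n.+1) (csq n) crh).
  pose F x := eps ^+ 2 * (h2 x * h x - h1 x ^+ 2 / 2)
      + c * (k%:R / k.+1%:R * h x ^+ k.+1).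
  have dF (x : R) : is_derive x 1 F (r x * h x).
    have := dhX k.+1 x; have := dh2 x; have := dh1 x => ? ? ?.
    apply: is_derive_eq; rewrite /r /GRing.scale/=.
    (* Differentiating [h^(k+1)] yields [h^k], while [r] contains [h^(k-1)]; the two match because
       [k] is positive, so that [k.-1] is a true predecessor. *)
    have hk : h x ^+ k = h x * h x ^+ k.-1 by rewrite -exprS prednK// ltnW.
    rewrite hk; field.
    by rewrite nat1r pnatr_eq0.
  apply: (Rintegral_torus_derive dF crh).
  by rewrite /F (real_trig_periodic hT) (real_trig_periodic h1T) (real_trig_periodic h2T).
rewrite -(weak _ hY); apply: eq_Rintegral => x _.
by rewrite /r /h /half_step; field; rewrite gt_eqF.
Qed.
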